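(* Let $\{a_n\}_{n=0}^\infty$ be a sequence in $\mathbb{C}$ such that $|a_n|>1$ for all $n\geq 1$, and such that for every $n\geq 1$ with $|a_{n+1}|<2$ we have $\left|(|a_{n+1}|^2-1)a_n+\overline{a_{n+1}}\right|\geq |a_{n+1}|^2$. Let $\{p_n\},\{q_n\}$ be the $\mathcal{Q}$-pair of $\{a_n\}$. Then $|q_{n+1}|>|q_n|$ for all $n\geq 1$.
   Context: For a sequence $\{a_n\}_{n\ge0}$ of complex numbers, its $\mathcal{Q}$-pair is defined by $p_{-1}=1$, $p_0=a_0$, $p_{n+1}=a_{n+1}p_n+p_{n-1}$ and $q_{-1}=0$, $q_0=1$, $q_{n+1}=a_{n+1}q_n+q_{n-1}$ for all $n\geq 0$. *)

(* Defs.v *)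
From Stdlib Require Import Reals ZArith Lia.
From Coquelicot Require Import Coquelicot.

(* p and q are indexed by Z so that the index -1 is literal; their values
   below -1 are irrelevant and left unconstrained. *)
Record is_Qpair (a : nat -> C) (p q : Z -> C) : Prop := {
  Qpair_p_m1 : p (-1)%Z = RtoC 1;
  Qpair_p_0 : p 0%Z = a 0%nat;
  Qpair_p_rec : forall n : nat,
    p (Z.of_nat n + 1)%Z
      = (a (n + 1)%nat * p (Z.of_nat n) + p (Z.of_nat n - 1)%Z)%C;
  Qpair_q_m1 : q (-1)%Z = RtoC 0;
  Qpair_q_0 : q 0%Z = RtoC 1;
  Qpair_q_rec : forall n : nat,
    q (Z.of_nat n + 1)%Z
      = (a (n + 1)%nat * q (Z.of_nat n) + q (Z.of_nat n - 1)%Z)%C }.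

Fixpoint Qrec (a : nat -> C) (x y : C) (n : nat) : C * C :=
  match n with
  | O => (x, y)
  | S m => let '(u, v) := Qrec a x y m in (v, (a (m + 1)%nat * v + u)%C)
  end.

Lemma is_Qpair_ex (a : nat -> C) : exists p q : Z -> C, is_Qpair a p q.
Proof.
pose (f := fun (x y : C) (k : Z) => fst (Qrec a x y (Z.to_nat (k + 1)))).
assert (Hrec : forall x y (n : nat), f x y (Z.of_nat n + 1)%Z
   = (a (n + 1)%nat * f x y (Z.of_nat n) + f x y (Z.of_nat n - 1)%Z)%C).
{ intros x y n; unfold f.
  replace (Z.to_nat (Z.of_nat n + 1 + 1)) with (S (S n)) by lia.
  replace (Z.to_nat (Z.of_nat n + 1)) with (S n) by lia.
  replace (Z.to_nat (Z.of_nat n - 1 + 1)) with n by lia.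
  simpl; destruct (Qrec a x y n) as [u v]; reflexivity. }
exists (f (RtoC 1) (a 0%nat)), (f (RtoC 0) (RtoC 1)).
split; try reflexivity; apply Hrec.
Qed.

(* Main.v *)
Require Import Defs.
From Stdlib Require Import Reals ZArith Lia Lra.
From Coquelicot Require Import Coquelicot.
Open Scope R_scope.

(** Put [b = a_(n+1)] and [B = |b|^2 - 1 > 0].  Completing the square,
    [B (|b z + x|^2 - |z|^2) = |B z + conj b x|^2 - |x|^2], so [|q_(n+1)| > |q_n|]
    holds exactly when [|B q_n + conj b q_(n-1)| > |q_(n-1)|].  Since
    [q_n = a_n q_(n-1) + q_(n-2)], the hypothesis on [a_n] bounds the left side
    from below by [|b|^2 |q_(n-1)| - B |q_(n-2)|], which exceeds [|q_(n-1)|]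
    as soon as [|q_(n-2)| < |q_(n-1)|].  When [|b| >= 2] the triangle
    inequality suffices. *)

Lemma Cmod_sqr (z : C) : Cmod z ^ 2 = fst z ^ 2 + snd z ^ 2.
Proof.
unfold Cmod; rewrite pow2_sqrt; nra.
Qed.

Lemma Cmod_affine_complete_square (b z x : C) :
  (Cmod b ^ 2 - 1) * (Cmod (b * z + x)%C ^ 2 - Cmod z ^ 2)
  = Cmod (RtoC (Cmod b ^ 2 - 1) * z + Cconj b * x)%C ^ 2 - Cmod x ^ 2.
Proof.
rewrite !Cmod_sqr.
destruct b as [b1 b2], z as [z1 z2], x as [x1 x2]; simpl; ring.
Qed.

Lemma Cmod_plus_ge (x y : C) : Cmod x - Cmod y <= Cmod (x + y)%C.
Proof.
pose proof (Cmod_triangle (x + y) (- y)) as H.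
replace (x + y + - y)%C with x in H by ring.
rewrite Cmod_opp in H; lra.
Qed.

Lemma Cmod_affine_gt (b z x : C) :
  1 < Cmod b ->
  Cmod x < Cmod (RtoC (Cmod b ^ 2 - 1) * z + Cconj b * x)%C ->
  Cmod z < Cmod (b * z + x)%C.
Proof.
intros hb hx.
pose proof (Cmod_affine_complete_square b z x) as E.
pose proof (Cmod_ge_0 x); pose proof (Cmod_ge_0 z).
pose proof (Cmod_ge_0 (b * z + x)%C).
set (m := Cmod (RtoC _ * z + _)%C) in *.
destruct (Rlt_or_le (Cmod z) (Cmod (b * z + x)%C)) as [h | h]; [exact h |].
(* Otherwise the left side of [E] is at most 0, while its right side [m ^ 2 - Cmod x ^ 2] is
   positive. *)
assert (Cmod (b * z + x)%C ^ 2 <= Cmod z ^ 2) by (apply pow_incr; lra).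
assert (0 < Cmod b ^ 2 - 1) by nra.
nra.
Qed.

Lemma Cmod_Qstep_gt (a b x y : C) :
  1 < Cmod b ->
  (Cmod b < 2 ->
     Cmod (RtoC (Cmod b ^ 2 - 1) * a + Cconj b)%C >= Cmod b ^ 2) ->
  Cmod y < Cmod x -> Cmod x < Cmod (a * x + y)%C ->
  Cmod (a * x + y)%C < Cmod (b * (a * x + y) + x)%C.
Proof.
intros hb hab hyx hxz.
pose proof (Cmod_ge_0 x).
destruct (Rlt_or_le (Cmod b) 2) as [b2 | b2].
- apply Cmod_affine_gt; [exact hb |].
  assert (B0 : 0 < Cmod b ^ 2 - 1) by nra.
  specialize (hab b2).
  set (B := Cmod b ^ 2 - 1) in *.
  (* Regrouping by [x] and [y] exposes the coefficient that [hab] bounds. *)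
  replace (RtoC B * (a * x + y) + Cconj b * x)%C
    with ((RtoC B * a + Cconj b) * x + RtoC B * y)%C by ring.
  pose proof (Cmod_plus_ge ((RtoC B * a + Cconj b) * x) (RtoC B * y)) as T.
  rewrite !Cmod_mult, Cmod_R, (Rabs_pos_eq B) in T by lra.
  assert (Cmod b ^ 2 * Cmod x <= Cmod (RtoC B * a + Cconj b)%C * Cmod x)
    by (apply Rmult_le_compat_r; lra).
  assert (B * Cmod y < B * Cmod x) by (apply Rmult_lt_compat_l; lra).
  unfold B in *; lra.
(* With [z = a * x + y]: [|b| |z| - |x| >= 2 |z| - |x| > |z|], by [hxz]. *)
- pose proof (Cmod_plus_ge (b * (a * x + y)) x) as T.
  rewrite Cmod_mult in T; nra.
Qed.

Theorem theorem3p2 (a : nat -> C) (p q : Z -> C)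
  (ha : forall n : nat, (1 <= n)%nat -> Cmod (a n) > 1)
  (ha2 : forall n : nat, (1 <= n)%nat -> Cmod (a (n + 1)%nat) < 2 ->
     Cmod (RtoC (Cmod (a (n + 1)%nat) ^ 2 - 1) * a n + Cconj (a (n + 1)%nat))%C
       >= Cmod (a (n + 1)%nat) ^ 2)
  (hpq : is_Qpair a p q) :
  forall n : nat, (1 <= n)%nat ->
    Cmod (q (Z.of_nat n + 1)%Z) > Cmod (q (Z.of_nat n)).
Proof.
destruct hpq as [_ _ _ qm1 q0 qrec].
(* The step needs two consecutive increases, so both are carried. Starting at index -1 makes the
   base case [0 < 1 < |a_1|]. *)
assert (key : forall n : nat,
  Cmod (q (Z.of_nat n - 1)%Z) < Cmod (q (Z.of_nat n)) /\
  Cmod (q (Z.of_nat n)) < Cmod (q (Z.of_nat n + 1)%Z)).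
{ induction n as [| n [IH1 IH2]].
  - rewrite qrec; simpl Z.of_nat; simpl Z.sub; rewrite qm1, q0.
    rewrite Cplus_0_r, Cmult_1_r, Cmod_0, Cmod_1.
    specialize (ha 1%nat (le_n 1)); simpl; lra.
  - replace (Z.of_nat (S n) - 1)%Z with (Z.of_nat n) by lia.
    rewrite (qrec (S n)).
    replace (Z.of_nat (S n) - 1)%Z with (Z.of_nat n) by lia.
    replace (Z.of_nat (S n)) with (Z.of_nat n + 1)%Z by lia.
    split; [exact IH2 |].
    rewrite (qrec n) in IH2 |- *.
    replace (S n) with (n + 1)%nat by lia.
    apply Cmod_Qstep_gt; [apply ha | apply ha2 | exact IH1 | exact IH2]; lia. }
intros n _; exact (proj2 (key n)).
Qed.
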